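(* Let $H$ and $V$ be complex Hilbert spaces such that $V$ is continuously and densely embedded into $H$, and let $a:V\times V\to\mathbb{C}$ be a continuous sesquilinear form with associated operator $A$ on $H$. For $\lambda\in\mathbb{C}$ put $a_\lambda(u,v):=a(u,v)-\lambda\langle u,v\rangle_H$ for $u,v\in V$. Assume that $a$ is symmetric and that there exists $\lambda\in\mathbb{C}$ such that $a_\lambda$ is essentially coercive. Then $A$ is selfadjoint and semibounded. Moreover, if $\lambda\in\mathbb{R}$, then $\sigma_{ess}(A)\subset(-\infty,\lambda)$ or $\sigma_{ess}(A)\subset(\lambda,\infty)$.
   Context: The operator $A$ associated with $a$ is the operator on $H$ with graph $\{(u,f)\in H\times H: u\in V,\ a(u,v)=\langle f,v\rangle_H \text{ for all } v\in V\}$. A continuous sesquilinear form $b:V\times V\to\mathbb{C}$ is essentially coercive if, for every sequence $(u_n)$ in $V$, $u_n\rightharpoonup 0$ weakly in $V$ and $b(u_n,u_n)\to 0$ imply $\|u_n\|_V\to 0$. Symmetric means $a(u,v)=\overline{a(v,u)}$ for all $u,v\in V$. Semibounded means bounded below or bounded above. The essential spectrum $\sigma_{ess}(A)$ of a closed operator $A$ is the set of all $\mu\in\mathbb{C}$ such that $\mu\,\mathrm{Id}-A$ is not Fredholm; a closed operator $T$ on $H$ is Fredholm if $\ker T$ and $H/\operatorname{range}(T)$ are finite dimensional. *)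

(* Defs.v *)
From HB Require Import structures.
From mathcomp Require Import all_boot all_order all_algebra sesquilinear.
From mathcomp Require Import complex.
From mathcomp Require Import all_classical all_reals all_analysis.

Set Implicit Arguments.
Unset Strict Implicit.
Unset Printing Implicit Defensive.

Import Order.TTheory GRing.Theory Num.Theory.
Import numFieldNormedType.Exports.

Local Open Scope classical_set_scope.
Local Open Scope complex_scope.
Local Open Scope ring_scope.

(* Norms of modules over R[i] take their values in R[i]; a <= b in R[i] means
   that b - a is real and nonnegative.  R[i] carries its usual topology under
   the alias R[i]^o.  Inner products and sesquilinear forms are linear in the
   first argument and conjugate-linear in the second. *)

HB.mixin Record isHilbert (R : realType) V of CompleteNormedModule R[i] V := {
  inner : {dot V for (@Num.conj R[i])} ;
  inner_norm : forall x : V, `|x| ^+ 2 = inner x x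
}.

#[short(type="hilbertType")]
HB.structure Definition Hilbert (R : realType) :=
  {V of isHilbert R V & CompleteNormedModule R[i] V}.

Notation "{ 'sesquilinear' V -> C }" :=
  {bilinear V -> V -> C | *%R & (@Num.conj C \; *%R)}
  (at level 0, V at level 98, C at level 99,
   format "{ 'sesquilinear'  V  ->  C }") : type_scope.

Section Forms.
Variables (R : realType) (V H : hilbertType R).

Definition is_continuous_form (b : V -> V -> R[i]) :=
  continuous (fun p : V * V => b p.1 p.2 : R[i]^o).

Definition is_symmetric_form (b : V -> V -> R[i]) :=
  forall u v, b u v = Num.conj (b v u).

Definition weak_cvg (u : V^nat) (l : V) :=
  forall phi : {linear V -> R[i]^o}, continuous phi ->
    phi (u n) @[n --> \oo] --> phi l.

Definition essentially_coercive (b : V -> V -> R[i]) :=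
  forall u : V^nat, weak_cvg u 0 ->
    (b (u n) (u n) : R[i]^o) @[n --> \oo] --> (0 : R[i]^o) ->
    (`|u n| : R[i]^o) @[n --> \oo] --> (0 : R[i]^o).

(* The embedding of V into H is a map j, so that V is identified with the
   range of j. *)
Definition shifted_form (j : V -> H) (a : V -> V -> R[i]) (lambda : R[i]) :
    V -> V -> R[i] :=
  fun u v => a u v - lambda * inner (j u) (j v).

Definition associated_operator (j : V -> H) (a : V -> V -> R[i]) :
    set (H * H) :=
  [set p | exists2 u : V, p.1 = j u & forall v, a u v = inner p.2 (j v)].

End Forms.

(* An unbounded operator on H is given by its graph. *)
Section Operators.
Variables (R : realType) (H : hilbertType R).
Implicit Types (G : set (H * H)) (S : set H) (mu : R[i]).

Definition is_operator G :=
  [/\ G (0, 0),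
      forall c p q, G p -> G q -> G (c *: p.1 + q.1, c *: p.2 + q.2) &
      forall x y z, G (x, y) -> G (x, z) -> y = z].

Definition domain G : set H := [set x | exists y, G (x, y)].

Definition range_of G : set H := [set y | exists x, G (x, y)].

Definition kernel_of G : set H := [set x | G (x, 0)].

Definition adjoint G : set (H * H) :=
  [set q | forall p, G p -> inner p.2 q.1 = inner p.1 q.2].

Definition selfadjoint G :=
  [/\ is_operator G, dense (domain G) & adjoint G = G].

(* The inequalities take place in R[i]: they also say that the values
   inner p.2 p.1 of the quadratic form are real. *)
Definition bounded_below G :=
  exists gamma : R, forall p, G p ->
    gamma%:C * `|p.1| ^+ 2 <= inner p.2 p.1.

Definition bounded_above G :=
  exists gamma : R, forall p, G p ->
    inner p.2 p.1 <= gamma%:C * `|p.1| ^+ 2.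

Definition semibounded G := bounded_below G \/ bounded_above G.

Definition finite_dim S :=
  exists (n : nat) (e : 'I_n -> H), (forall i, S (e i)) /\
    forall x, S x -> exists c : 'I_n -> R[i], x = \sum_(i < n) c i *: e i.

(* H / S is spanned by the classes of finitely many vectors e i. *)
Definition finite_dim_quotient S :=
  exists (n : nat) (e : 'I_n -> H),
    forall x, exists c : 'I_n -> R[i], S (x - \sum_(i < n) c i *: e i).

Definition fredholm G :=
  finite_dim (kernel_of G) /\ finite_dim_quotient (range_of G).

(* The graph of mu Id - A, where G is the graph of A. *)
Definition id_minus mu G : set (H * H) :=
  [set (p.1, mu *: p.1 - p.2) | p in G].

Definition essential_spectrum G : set R[i] :=
  [set mu | ~ fredholm (id_minus mu G)].

End Operators.

(* Main.v *)
(** With [k := Im lambda] and [q u := a u u - Re lambda |j u|^2], essential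
    coercivity says that no sequence of unit vectors tending weakly to [0]
    satisfies both [q (u n) --> 0] and [k |j (u n)|^2 --> 0].  Orthonormal
    sequences tend weakly to [0], so on the orthogonal complement of a finite
    orthonormal family unit vectors with [k |j w|^2] small have [|q w|] bounded
    away from [0].  A vector [u] with [q u < 0] and an orthogonal vector [v] with
    [q v > 0] span a zero of [q]; hence, after adding at most one vector to the
    family, [q] has a constant sign there.  Since the functionals
    [u |-> inner (j u) y] are dense in the dual of [V], it follows that
      [alpha |u|^2 <= sg * q u + C * sum_i |inner (j u) (y i)|^2 + K |k| |j u|^2]
    with [sg = 1] or [sg = -1] and finitely many vectors [y i] of [H].  Bounding
    the sum by a multiple of [|j u|^2] makes [sg * a] elliptic, and Lax-Milgram
    gives selfadjointness and semiboundedness.  If [k = 0], then for real [mu]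
    on the good side of [lambda] a finite rank perturbation of [A - mu] is
    invertible, so [A - mu] is Fredholm; for nonreal [mu] the form of [A - mu]
    becomes coercive after multiplication by a suitable complex number. *)

Require Import Defs.
From HB Require Import structures.
From mathcomp Require Import all_boot all_order all_algebra sesquilinear.
From mathcomp Require Import complex.
From mathcomp Require Import all_classical all_reals all_analysis.
From mathcomp Require Import ring lra.

Set Implicit Arguments.
Unset Strict Implicit.
Unset Printing Implicit Defensive.

Import Order.TTheory GRing.Theory Num.Theory.
Import numFieldNormedType.Exports.

Local Open Scope classical_set_scope.
Local Open Scope complex_scope.
Local Open Scope ring_scope.

(** * Real-valued norms and complex arithmetic *)

Lemma gt0_complex (R : realType) (d : R[i]) :
  0 < d -> exists2 r : R, 0 < r & d = r%:C.
Proof.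
move=> d0; have dr : (complex.Re d)%:C = d by rewrite RRe_real // gtr0_real.
by exists (complex.Re d); rewrite ?dr // -ltcR dr.
Qed.

Section RealNorm.
Variables (R : realType) (X : normedZmodType R[i]).
Implicit Types x y : X.

(** Norms lie in [R[i]] but are real, so taking the real part loses nothing and moves all estimates
    to the ordered field [R]. *)
Definition nm x : R := complex.Re `|x|.

Lemma nmE x : `|x| = (nm x)%:C.
Proof. by rewrite /nm RRe_real // ger0_real. Qed.

Lemma norm_lt x (r : R) : (`|x| < r%:C) = (nm x < r).
Proof. by rewrite nmE ltcR. Qed.

Lemma nm_ge0 x : 0 <= nm x.
Proof. by rewrite -ler0c -nmE. Qed.

Lemma nm0 : nm 0 = 0.
Proof. by rewrite /nm normr0. Qed.

Lemma nm_eq0 x : nm x = 0 -> x = 0.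
Proof. by move=> nx; apply: normr0_eq0; rewrite nmE nx. Qed.

Lemma nm_gt0 x : x != 0 -> 0 < nm x.
Proof. by rewrite -normr_gt0 nmE -[0]/(0%:C) ltcR. Qed.

Lemma nmN x : nm (- x) = nm x.
Proof. by rewrite /nm normrN. Qed.

Lemma nm_sub x y : nm (x - y) = nm (y - x).
Proof. by rewrite -nmN opprB. Qed.

Lemma nmD x y : nm (x + y) <= nm x + nm y.
Proof. by rewrite -lecR rmorphD /= -!nmE ler_normD. Qed.

End RealNorm.

Section ComplexNumbers.
Variable R : realType.
Implicit Types c d : R[i].

Lemma nmM c d : nm (c * d) = nm c * nm d.
Proof. by apply: complexI; rewrite rmorphM /= -!nmE normrM. Qed.

Lemma abs_Re_le c : `|complex.Re c| <= nm c.
Proof. by rewrite -lecR -nmE normc_ge_Re. Qed.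

Lemma nmJ c : nm c^*%C = nm c.
Proof. by rewrite /nm normcJ. Qed.

Lemma mulcJ c : c^*%C * c = (nm c ^+ 2)%:C.
Proof. by rewrite mulrC -sqr_normc nmE rmorphXn. Qed.

Lemma nmR (r : R) : nm r%:C = `|r|.
Proof. by rewrite /nm normc_def /= expr0n /= addr0 sqrtr_sqr. Qed.

Lemma nm_nat n : nm (n%:R : R[i]) = n%:R.
Proof. by rewrite -(rmorph_nat (real_complex R)) nmR ger0_norm. Qed.

Lemma cReD c d : complex.Re (c + d) = complex.Re c + complex.Re d.
Proof. by case: c d => [? ?] [? ?]. Qed.

Lemma cReN c : complex.Re (- c) = - complex.Re c.
Proof. by case: c. Qed.

Lemma cReJ c : complex.Re c^*%C = complex.Re c.
Proof. by case: c. Qed.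

Lemma cReMr (r : R) c : complex.Re (r%:C * c) = r * complex.Re c.
Proof. by case: c => x y /=; rewrite mul0r subr0. Qed.

Lemma conjD c d : (c + d)^*%C = c^*%C + d^*%C.
Proof. exact: rmorphD. Qed.

Lemma conjM c d : (c * d)^*%C = c^*%C * d^*%C.
Proof. exact: rmorphM. Qed.

End ComplexNumbers.

Lemma nmZ (R : realType) (W : normedModType R[i]) (c : R[i]) (u : W) :
  nm (c *: u) = nm c * nm u.
Proof. by apply: complexI; rewrite rmorphM /= -!nmE normrZ. Qed.

(** * Inner products and completeness *)

Section Hilbert.
Variables (R : realType) (V : hilbertType R).
Implicit Types (u v w x y : V) (c : R[i]).

Lemma innerDl u v w : inner (u + v) w = inner u w + inner v w.
Proof. exact: linearDl. Qed.

Lemma innerZl c u v : inner (c *: u) v = c * inner u v.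
Proof. exact: linearZl_LR. Qed.

Lemma innerDr u v w : inner w (u + v) = inner w u + inner w v.
Proof. exact: linearDr. Qed.

Lemma innerZr c u v : inner u (c *: v) = c^*%C * inner u v.
Proof. exact: linearZr_LR. Qed.

Lemma inner0l u : inner 0 u = 0. Proof. exact: linear0l. Qed.

Lemma inner0r u : inner u 0 = 0. Proof. exact: linear0r. Qed.

Lemma innerNr u v : inner u (- v) = - inner u v. Proof. exact: linearNr. Qed.

Lemma innerBl u v w : inner (u - v) w = inner u w - inner v w.
Proof. exact: linearBl. Qed.

Lemma innerBr u v w : inner w (u - v) = inner w u - inner w v.
Proof. exact: linearBr. Qed.

Lemma innerC u v : inner u v = (inner v u)^*%C.
Proof. by rewrite (hermC inner u v) /= expr0 mul1r. Qed.

Lemma innerxx x : inner x x = (nm x ^+ 2)%:C.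
Proof. by rewrite -inner_norm nmE rmorphXn. Qed.

Lemma inner_suml I (r : seq I) P (F : I -> V) v :
  inner (\sum_(i <- r | P i) F i) v = \sum_(i <- r | P i) inner (F i) v.
Proof.
apply: (big_morph (fun u => inner u v)) => [x y|]; first exact: innerDl.
exact: inner0l.
Qed.

Lemma nm_sqrD u v :
  nm (u + v) ^+ 2 = nm u ^+ 2 + nm v ^+ 2 + 2 * complex.Re (inner u v).
Proof.
have -> : nm (u + v) ^+ 2 = complex.Re (inner (u + v) (u + v)).
  by rewrite innerxx.
by rewrite innerDl !innerDr !innerxx [inner v u]innerC !cReD cReJ /=; ring.
Qed.

(** The triangle inequality comes with the normed structure; squaring it gives this bound. *)
Lemma Re_inner_le u v : complex.Re (inner u v) <= nm u * nm v.
Proof.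
have := nm_sqrD u v; have := nmD u v; have := nm_ge0 (u + v).
have := nm_ge0 u; have := nm_ge0 v; nra.
Qed.

(** Multiplying [u] by the conjugate of [inner u v] makes the inner product real and nonnegative,
    which reduces the claim to [Re_inner_le]. *)
Lemma cauchy_schwarz u v : nm (inner u v) <= nm u * nm v.
Proof.
have [->|n0] := eqVneq (inner u v) 0; first by rewrite nm0 mulr_ge0 ?nm_ge0.
have := Re_inner_le ((inner u v)^*%C *: u) v.
rewrite innerZl mulcJ nmZ nmJ /= expr2 -mulrA ler_pM2l //; exact: nm_gt0.
Qed.

Lemma parallelogram u v :
  nm (u + v) ^+ 2 + nm (u - v) ^+ 2 = 2 * (nm u ^+ 2 + nm v ^+ 2).
Proof. rewrite !nm_sqrD nmN innerNr cReN; ring. Qed.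

Definition tends (f : nat -> V) (l : V) :=
  forall e : R, 0 < e -> exists N, forall n, (N <= n)%N -> nm (f n - l) < e.

Lemma complete_nm (f : nat -> V) :
  (forall e : R, 0 < e ->
     exists N, forall n m, (N <= n)%N -> (N <= m)%N -> nm (f n - f m) < e) ->
  exists l, tends f l.
Proof.
move=> fC.
have : cvg (f @ \oo).
  apply/cauchy_cvgP/cauchy_exP => e e0.
  have [r r0 ->] := gt0_complex e0; have [N fN] := fC _ r0.
  by exists (f N), N => // n /= nN; rewrite -ball_normE /= norm_lt fN.
move=> /cvg_ex[l fl]; exists l => e e0.
have /cvgr_dist_lt/(_ e%:C) := fl; rewrite -[0]/(0%:C) ltcR => /(_ e0).
by move=> [N _ fN]; exists N => n /fN /=; rewrite norm_lt nm_sub.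
Qed.

End Hilbert.

(** * Orthogonal projection and Riesz representation *)

Section Projection.
Variables (R : realType) (V : hilbertType R).
Implicit Types (u v w x y z f : V) (c : R[i]) (S : set V).

Lemma natSinv_lt (e : R) : 0 < e ->
  exists N, forall n, (N <= n)%N -> n.+1%:R^-1 < e.
Proof.
move=> e0; have [N _ HN] := near_infty_natSinv_lt (PosNum e0).
by exists N => n nN; exact: HN.
Qed.

(** The choice [c = inner z s / |s|^2] lowers [|z|^2] by [|inner z s|^2 / |s|^2], so minimality
    forces the inner product to vanish. *)
Lemma min_norm_orth z s : (forall c, nm z <= nm (z - c *: s)) -> inner z s = 0.
Proof.
move=> zmin; apply: nm_eq0.
have [->|s0] := eqVneq s 0; first by rewrite inner0r nm0.
set p := inner z s; have ns := nm_gt0 s0.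
have := zmin (((nm s ^+ 2)^-1)%:C * p).
rewrite -(ler_pXn2r (ltn0Sn 1)) ?nnegrE ?nm_ge0 // nm_sqrD nmN nmZ nmM nmR.
have -> : complex.Re (inner z (- ((((nm s ^+ 2)^-1)%:C * p) *: s))) =
    - ((nm s ^+ 2)^-1 * nm p ^+ 2).
  by rewrite innerNr innerZr -/p conjM conjc_real -mulrA mulcJ -rmorphM.
rewrite ger0_norm ?invr_ge0 ?sqr_ge0 //.
have -> : ((nm s ^+ 2)^-1 * nm p * nm s) ^+ 2 = (nm s ^+ 2)^-1 * nm p ^+ 2.
  by field; rewrite gt_eqF.
move=> h; have {h} : (nm s ^+ 2)^-1 * nm p ^+ 2 <= 0 by lra.
rewrite pmulr_rle0 ?invr_gt0 ?exprn_gt0 // => h.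
by apply/eqP; rewrite -sqrf_eq0 eq_le h sqr_ge0.
Qed.

Definition is_subspace S := S 0 /\ forall c x y, S x -> S y -> S (c *: x + y).

(* [z] is the component of [f] orthogonal to the closure of [S]. *)
Lemma projection S f : is_subspace S ->
  exists z, (forall s, S s -> inner z s = 0) /\
    forall e : R, 0 < e -> exists2 s, S s & nm (f - s - z) < e.
Proof.
move=> [S0 SL].
have SZ c x : S x -> S (c *: x) by move=> Sx; rewrite -[_ *: _]addr0; apply: SL.
have SD x y : S x -> S y -> S (x + y).
  by move=> Sx Sy; rewrite -[x]scale1r; apply: SL.
pose D : set R := [set nm (f - s) | s in S].
have D_inf : has_inf D.
  split; first by exists (nm (f - 0)), 0.
  by exists 0 => _ [s _ <-]; exact: nm_ge0.
pose d := inf D.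
have d_le s : S s -> d <= nm (f - s).
  by move=> Ss; apply: ge_inf; [exact: D_inf.2|exists s].
have d0 : 0 <= d.
  by apply: lb_le_inf; [exact: D_inf.1|move=> _ [s _ <-]; exact: nm_ge0].
have /choice[s sP] (n : nat) : exists s, S s /\ nm (f - s) < d + n.+1%:R^-1.
  have [|_ [s Ss <-] ?] := @inf_adherent _ D n.+1%:R^-1 _ D_inf.
    by rewrite invr_gt0.
  by exists s.
have [e e0|z zP] := @complete_nm _ _ (fun n => f - s n).
  (* By the parallelogram law, two residuals of norm below [d + t] whose midpoint has norm at least
     [d] differ by less than [e]: the squared distance is below
     [4 (d + t)^2 - 4 d^2 <= t (8 d + 4)], since [t <= 1]. *)
  pose t := Num.min 1 (e ^+ 2 / (8 * d + 5)).
  have t0 : 0 < t by rewrite lt_min ltr01 divr_gt0 ?exprn_gt0 //; lra.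
  have [N HN] := natSinv_lt t0.
  exists N => n m nN mN.
  have xn : nm (f - s n) < d + t by apply: lt_trans (sP n).2 _; rewrite ltrD2l HN.
  have xm : nm (f - s m) < d + t by apply: lt_trans (sP m).2 _; rewrite ltrD2l HN.
  have xnm : 2 * d <= nm (f - s n + (f - s m)).
    have -> : f - s n + (f - s m) = 2%:R *: (f - 2%:R^-1 *: (s n + s m)).
      rewrite scalerBr scalerA divff ?pnatr_eq0 // scale1r scaler_nat mulr2n.
      by rewrite addrACA opprD.
    by rewrite nmZ nm_nat ler_pM2l // d_le //; apply/SZ/SD; [exact: (sP n).1|exact: (sP m).1].
  have := parallelogram (f - s n) (f - s m).
  have t1 : t <= 1 by rewrite ge_min lexx.
  have te : t * (8 * d + 5) <= e ^+ 2.
    by rewrite -ler_pdivlMr; [rewrite /t ge_min lexx orbT|lra].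
  have := nm_ge0 (f - s n); have := nm_ge0 (f - s m).
  set A := nm _ in xm *; set B := nm _ in xn *; set C := nm _ in xnm *.
  set E := nm _ => A0 B0 hE.
  have hA : A ^+ 2 <= (d + t) ^+ 2 by nra.
  have hB : B ^+ 2 <= (d + t) ^+ 2 by nra.
  have hC : (2 * d) ^+ 2 <= C ^+ 2 by nra.
  have hE2 : E ^+ 2 < e ^+ 2 by nra.
  by rewrite -(ltr_pXn2r (ltn0Sn 1)) ?nnegrE ?nm_ge0 // ltW.
exists z; split=> [r Sr|e e0]; last first.
  have [N HN] := zP _ e0; exists (s N); [exact: (sP N).1|exact: HN].
(* [nm z <= d] since [z] is the limit of minimizing residuals; [d <= nm (z - c *: r)] since
   [z - c *: r] is the limit of the residuals [f - (s N + c *: r)]. *)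
apply: min_norm_orth => c; apply: (@le_trans _ _ d); apply/ler_addgt0Pr => e e0.
  have [N HN] := zP _ (divr_gt0 e0 (ltr0Sn _ 1)).
  have [M HM] := natSinv_lt (divr_gt0 e0 (ltr0Sn _ 1)).
  have := (sP (maxn N M)).2; have := HN _ (leq_maxl N M); have := HM _ (leq_maxr N M).
  rewrite nm_sub; have := nmD (z - (f - s (maxn N M))) (f - s (maxn N M)).
  rewrite subrK; move: (_.+1%:R^-1) => q; lra.
have [N /(_ N (leqnn N)) HN] := zP _ e0.
have := d_le _ (SD _ _ (sP N).1 (SZ c _ Sr)).
have := nmD (z - c *: r) (f - s N - z).
have -> : z - c *: r + (f - s N - z) = f - (s N + c *: r).
  by rewrite addrC addrA subrK opprD addrA.
lra.
Qed.

(** If [phi f != 0], let [z] be the component of [f] orthogonal to the kernel of [phi]. Boundedness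
    gives [phi z = phi f], and [v - (phi v / phi z) *: z] lies in the kernel, hence is orthogonal to
    [z]; solving for [phi v] yields a multiple of [z] as representative. *)
Lemma riesz (phi : V -> R[i]) (M : R) :
  (forall c x y, phi (c *: x + y) = c * phi x + phi y) ->
  (forall x, nm (phi x) <= M * nm x) ->
  exists z, forall v, phi v = inner v z.
Proof.
move=> phiL phiM.
have phi0 : phi 0 = 0 by have := phiL (-1) 0 0; rewrite scaleN1r addNr mulN1r addNr.
have phiB x y : phi (x - y) = phi x - phi y.
  by rewrite addrC -scaleN1r phiL mulN1r addrC.
have [[f fN0]|] := pselect (exists f, phi f != 0); last first.
  move=> nf; exists 0 => v; rewrite inner0r; apply/eqP/negPn/negP => pv.
  by apply: nf; exists v.
have [|z [zO zP]] := @projection [set x | phi x = 0] f.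
  by split=> // c x y /= px py; rewrite phiL px py mulr0 addr0.
have M0 : 0 <= M.
  have := phiM f; have := nm_gt0 fN0.
  have : 0 < nm f by apply: nm_gt0; apply: contra_neq fN0 => ->.
  nra.
have pz : phi z = phi f.
  apply/eqP; rewrite eq_sym -subr_eq0; apply/eqP/nm_eq0/eqP.
  rewrite eq_le nm_ge0 andbT; apply/ler_addgt0Pr => e e0.
  have [|s /= ps hs] := zP (e / (M + 1)); first by rewrite divr_gt0 //; lra.
  have -> : phi f - phi z = phi (f - s - z) by rewrite !phiB ps subr0.
  rewrite add0r; apply: (le_trans (phiM _)).
  have : nm (f - s - z) * (M + 1) <= e by rewrite -ler_pdivlMr ?ltW //; lra.
  have := nm_ge0 (f - s - z); nra.
have z0 : z != 0 by apply: contra_neq fN0 => z0; rewrite -pz z0.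
have nz : nm z ^+ 2 != 0 by rewrite expf_neq0 // gt_eqF // nm_gt0.
have nzc : (nm z ^+ 2)%:C != 0 :> R[i] by rewrite -[0]/(0%:C) (inj_eq (@complexI R)).
have pz0 : phi z != 0 by rewrite pz.
exists ((phi z / (nm z ^+ 2)%:C)^*%C *: z) => v.
rewrite innerZr conjcK.
have : inner z (v - (phi v / phi z) *: z) = 0.
  by apply: zO => /=; rewrite phiB -[_ *: z]addr0 phiL phi0 addr0 divfK ?subrr.
rewrite innerBr innerZr innerxx => /eqP; rewrite subr_eq0 => /eqP.
move=> /(congr1 (@conjc R)); rewrite -innerC conjM conjcK conjc_real => ->.
by move: (_%:C) nzc => t t0; field; rewrite pz0 t0.
Qed.

End Projection.

(** * The Lax-Milgram lemma *)

Section LaxMilgram.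
Variables (R : realType) (V : hilbertType R).
Implicit Types (u v w x y z f : V) (k : R[i]).

(** Stated for plain functions because it is applied to forms given by explicit formulas, such as
    [perturbed]. *)
Definition is_sesquilinear (c : V -> V -> R[i]) :=
  (forall k u u' v, c (k *: u + u') v = k * c u v + c u' v) /\
  (forall k u v v', c u (k *: v + v') = k^*%C * c u v + c u v').

Lemma inner_eq0 f : (forall v, inner f v = 0) -> f = 0.
Proof.
move=> /(_ f); rewrite innerxx -[0]/(0%:C) => /complexI/eqP.
by rewrite sqrf_eq0 => /eqP; exact: nm_eq0.
Qed.

Lemma coercive_eq0 (c : V -> V -> R[i]) (alpha : R) u : 0 < alpha ->
  alpha * nm u ^+ 2 <= complex.Re (c u u) -> c u u = 0 -> u = 0.
Proof.
move=> a0 + cu; rewrite cu /= pmulr_rle0 // => h.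
by apply: nm_eq0; apply/eqP; rewrite -sqrf_eq0 eq_le h sqr_ge0.
Qed.

(** Riesz turns [c] into an operator [T] and [phi] into a vector [f]. A vector [z] orthogonal to the
    range of [T] has [c z z = 0], so it vanishes and [f] is a limit of vectors [T (u n)]. Coercivity
    bounds [T] from below, so [u n] is Cauchy and its limit solves the equation. *)
Lemma lax_milgram (c : V -> V -> R[i]) (M alpha L : R) (phi : V -> R[i]) :
  is_sesquilinear c -> (forall u v, nm (c u v) <= M * nm u * nm v) ->
  0 < alpha -> (forall u, alpha * nm u ^+ 2 <= complex.Re (c u u)) ->
  (forall k x y, phi (k *: x + y) = k * phi x + phi y) ->
  (forall x, nm (phi x) <= L * nm x) ->
  exists u, forall v, c u v = (phi v)^*%C.
Proof.
move=> cS cM a0 ca phiL phiM; have [cl cr] := cS.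
have [f fP] := riesz phiL phiM.
have /choice[T TP] u : exists t, forall v, c u v = inner t v.
  have [k x y|x|t tP] := @riesz _ _ (fun v => (c u v)^*%C) (M * nm u).
  - by rewrite cr conjD conjM conjcK.
  - by rewrite nmJ.
  - by exists t => v; rewrite innerC -tP conjcK.
have TL k u u' : T (k *: u + u') = k *: T u + T u'.
  apply/eqP; rewrite -subr_eq0; apply/eqP/inner_eq0 => v.
  by rewrite innerBl innerDl innerZl -!TP cl subrr.
have TB u u' : T (u - u') = T u - T u'.
  by rewrite [u - u']addrC -[- u']scaleN1r TL scaleN1r addrC.
have T0 : T 0 = 0 by have := TB 0 0; rewrite !subrr.
have T_ge u : alpha * nm u <= nm (T u).
  have [->|u0] := eqVneq u 0; first by rewrite T0 !nm0 mulr0.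
  rewrite -(ler_pM2r (nm_gt0 u0)) -mulrA -expr2; apply: (le_trans (ca u)).
  by rewrite TP Re_inner_le.
have T_le u : nm (T u) <= M * nm u.
  have [->|Tu0] := eqVneq (T u) 0.
    rewrite nm0; have [->|u0] := eqVneq u 0; first by rewrite nm0 mulr0.
    by have := cM u u; have := nm_ge0 (c u u); have := nm_gt0 u0; nra.
  rewrite -(ler_pM2r (nm_gt0 Tu0)); apply: le_trans (cM u (T u)).
  by rewrite TP innerxx nmR ger0_norm ?sqr_ge0 // expr2.
have [|z [zO zP]] := @projection _ _ (range T) f.
  split; first by exists 0.
  by move=> k _ _ [x _ <-] [y _ <-]; exists (k *: x + y).
have z0 : z = 0.
  by apply: (coercive_eq0 a0 (ca z)); rewrite TP innerC zO ?conjc0.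
have /choice[u uP] (n : nat) : exists u, nm (f - T u) < n.+1%:R^-1.
  have [|_ [u _ <-]] := zP n.+1%:R^-1; first by rewrite invr_gt0.
  by rewrite z0 subr0 => ?; exists u.
have [e e0|w wP] := @complete_nm _ _ u.
  have [N HN] := natSinv_lt (divr_gt0 (mulr_gt0 a0 e0) (ltr0Sn _ 1)).
  exists N => n m nN mN; rewrite -(ltr_pM2l a0); apply: (le_lt_trans (T_ge _)).
  rewrite TB; have := uP n; have := uP m; have := HN _ nN; have := HN _ mN.
  have := nmD (f - T (u m)) (T (u n) - f).
  rewrite addrC subrKA (nm_sub (T (u n)) f).
  by move: (n.+1%:R^-1) (m.+1%:R^-1) => r r'; lra.
exists w => v; rewrite TP fP -innerC; suff -> : T w = f by []; apply/eqP.
rewrite eq_sym -subr_eq0; apply/eqP/nm_eq0/eqP.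
rewrite eq_le nm_ge0 andbT; apply/ler_addgt0Pr => e e0; rewrite add0r.
have M1 : 0 < `|M| + 1 by have := normr_ge0 M; lra.
have [N HN] := natSinv_lt (divr_gt0 e0 (ltr0Sn _ 1)).
have [N' HN'] := wP (e / 2 / (`|M| + 1)) (divr_gt0 (divr_gt0 e0 (ltr0Sn _ 1)) M1).
set n := maxn N N'.
have := uP n; have := HN _ (leq_maxl N N'); have := HN' _ (leq_maxr N N').
rewrite ltr_pdivlMr // -/n; have := nmD (f - T (u n)) (T (u n) - T w).
rewrite subrKA -TB; have := T_le (u n - w); have := ler_norm M.
have := nm_ge0 (u n - w); move: (n.+1%:R^-1) => r; nra.
Qed.

End LaxMilgram.

(** * Boundedness from continuity *)

Section Bounded.
Variables (R : realType).

Lemma linear_nm_bounded (V W : normedModType R[i]) (f : {linear V -> W}) :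
  continuous f -> exists M : R, forall u, nm (f u) <= M * nm u.
Proof.
move=> /(_ 0) /cvgrPdist_lt /(_ 1%:C); rewrite ltcR ltr01 => /(_ isT).
move=> /nbhs_ballP[d /= /gt0_complex[r r0 ->] dP].
exists (2 / r) => u; have [->|u0] := eqVneq u 0; first by rewrite linear0 !nm0 mulr0.
(* The factor [t] brings [u] to norm [r / 2], inside the ball where [f] takes values of norm below
   [1]. *)
have nu := nm_gt0 u0; pose t := r / (2 * nm u).
have t0 : 0 < t by rewrite divr_gt0 ?mulr_gt0.
have tu : t * nm u = r / 2 by rewrite /t; field; rewrite gt_eqF.
have := dP (t%:C *: u).
rewrite -ball_normE /= linear0 !sub0r !normrN !norm_lt linearZ /= !nmZ nmR.
rewrite gtr0_norm // tu => /(_ _) h.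
have {}h : t * nm (f u) < 1 by apply: h; lra.
rewrite -(ler_pM2l t0) mulrCA tu; apply: (le_trans (ltW h)).
by rewrite le_eqVlt; apply/orP; left; apply/eqP; field; rewrite gt_eqF.
Qed.

Lemma form_nm_bounded (V : hilbertType R) (a : {sesquilinear V -> R[i]}) :
  is_continuous_form a ->
  exists M : R, forall u v, nm (a u v) <= M * nm u * nm v.
Proof.
move=> /(_ (0, 0)) /cvgrPdist_lt /(_ 1%:C); rewrite ltcR ltr01 => /(_ isT).
move=> /nbhs_ballP[d /= /gt0_complex[r r0 ->] dP].
exists ((2 / r) ^+ 2) => u v.
have [->|u0] := eqVneq u 0; first by rewrite linear0l !nm0 mulr0 mul0r.
have [->|v0] := eqVneq v 0; first by rewrite linear0r !nm0 mulr0.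
have nu := nm_gt0 u0; have nv := nm_gt0 v0.
pose t := r / (2 * nm u); pose s := r / (2 * nm v).
have t0 : 0 < t by rewrite divr_gt0 ?mulr_gt0.
have s0 : 0 < s by rewrite divr_gt0 ?mulr_gt0.
have tu : t * nm u = r / 2 by rewrite /t; field; rewrite gt_eqF.
have sv : s * nm v = r / 2 by rewrite /s; field; rewrite gt_eqF.
have : ball ((0, 0) : V * V) r%:C (t%:C *: u, s%:C *: v).
  by split; rewrite -ball_normE /= sub0r normrN norm_lt nmZ nmR gtr0_norm //; lra.
move=> /dP /=; rewrite linear0l sub0r normrN norm_lt linearZl_LR linearZr_LR /= => h.
have ts0 := mulr_gt0 t0 s0.
move: h; rewrite (_ : Num.conj s%:C = s%:C); last exact: conjc_real.
rewrite !nmM !nmR !gtr0_norm // mulrA => h.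
rewrite -(ler_pM2l ts0); apply: (le_trans (ltW h)).
have -> : t * s * ((2 / r) ^+ 2 * nm u * nm v) = (2 / r) ^+ 2 * (t * nm u) * (s * nm v).
  by ring.
rewrite tu sv le_eqVlt; apply/orP; left; apply/eqP; field; rewrite gt_eqF //.
Qed.

End Bounded.

(** * Orthonormal families and sequences *)

Section Orthonormal.
Variables (R : realType) (V : hilbertType R).
Implicit Types (u v w y : V) (e : nat -> V).

(** A finite family is a sequence whose entries from index [n] on are unconstrained, so that
    families of all lengths share one type. *)
Definition orthonormal_upto n e := forall i j, (i < n)%N -> (j < n)%N ->
  inner (e i) (e j) = (i == j)%:R.

Definition proj_on n e u := \sum_(i < n) inner u (e i) *: e i.

Lemma proj_on_orth n e u : orthonormal_upto n e ->
  forall i, (i < n)%N -> inner (u - proj_on n e u) (e i) = 0.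
Proof.
move=> eO i ni; rewrite innerBl inner_suml (bigD1 (Ordinal ni)) //=.
rewrite innerZl eO // eqxx mulr1 big1 ?addr0 ?subrr // => k ki.
by rewrite innerZl eO // (negbTE (_ : nat_of_ord k != i)) ?mulr0.
Qed.

Lemma inner_proj_on n e u v :
  inner v (proj_on n e u) = \sum_(i < n) (inner u (e i))^*%C * inner v (e i).
Proof.
rewrite innerC inner_suml rmorph_sum /=; apply: eq_bigr => i _.
by rewrite innerZl conjM [inner v _]innerC.
Qed.

Lemma nm_proj_on n e u : orthonormal_upto n e ->
  nm (proj_on n e u) ^+ 2 = \sum_(i < n) nm (inner u (e i)) ^+ 2 /\
  nm u ^+ 2 = nm (u - proj_on n e u) ^+ 2 + nm (proj_on n e u) ^+ 2.
Proof.
move=> eO; have oP : inner (u - proj_on n e u) (proj_on n e u) = 0.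
  by rewrite inner_proj_on big1 // => i _; rewrite proj_on_orth ?mulr0.
split.
  apply: complexI; rewrite -innerxx.
  transitivity (inner u (proj_on n e u)).
    by apply/esym/eqP; rewrite -subr_eq0 -innerBl oP.
  rewrite inner_proj_on rmorph_sum /=; apply: eq_bigr => i _.
  by rewrite mulcJ.
by have := nm_sqrD (u - proj_on n e u) (proj_on n e u); rewrite subrK oP mulr0 addr0.
Qed.

(** By Bessel's inequality the series of [nm (inner y (e i)) ^+ 2] has partial sums below
    [nm y ^+ 2], so its terms tend to [0]. *)
Lemma bessel_cvg0 e y : (forall n, orthonormal_upto n e) ->
  forall d : R, 0 < d -> exists N, forall n, (N <= n)%N -> nm (inner y (e n)) < d.
Proof.
move=> eO d d0; pose f i := nm (inner y (e i)) ^+ 2.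
have f_cvg : cvgn (series f).
  apply: nondecreasing_is_cvgn.
    apply/nondecreasing_seqP => n; rewrite !seriesEnat /= big_nat_recr //=.
    by rewrite lerDl sqr_ge0.
  exists (nm y ^+ 2) => _ [n _ <-]; rewrite seriesEord /=.
  have [<- ->] := nm_proj_on y (eO n).
  by rewrite lerDr sqr_ge0.
have /cvgrPdist_lt /(_ _ (exprn_gt0 2 d0)) := cvg_series_cvg_0 f_cvg.
move=> [N _ HN]; exists N => n /HN /=.
rewrite sub0r normrN ger0_norm ?sqr_ge0 //.
by rewrite ltr_pXn2r ?nnegrE ?nm_ge0 // ltW.
Qed.

Lemma orthonormal_rcons n e w : orthonormal_upto n e -> nm w = 1 ->
  (forall i, (i < n)%N -> inner w (e i) = 0) ->
  orthonormal_upto n.+1 (fun i => if i == n then w else e i).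
Proof.
move=> eO w1 we i j; rewrite !ltnS => ni nj.
have [ei|iN] := eqVneq i n; have [ej|jN] := eqVneq j n.
- by rewrite innerxx w1 expr1n ei ej eqxx.
- by rewrite we ?ltn_neqAle ?jN // ei eq_sym (negbTE jN).
- by rewrite innerC we ?ltn_neqAle ?iN // ej (negbTE iN) conjc0.
- by rewrite eO // ltn_neqAle ?iN ?jN.
Qed.

Lemma orthonormal_sequence (P : nat -> V -> Prop) :
  (forall n e, orthonormal_upto n e -> exists w,
     [/\ nm w = 1, forall i, (i < n)%N -> inner w (e i) = 0 & P n w]) ->
  exists e, (forall n, orthonormal_upto n e) /\ forall n, P n (e n).
Proof.
move=> H.
(* Dependent choice: [F] picks an extension of each finite orthonormal family, with default value
   [0] on all other families. *)
have /choice[F FP] (p : nat * (nat -> V)) : exists w, orthonormal_upto p.1 p.2 ->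
    [/\ nm w = 1, forall i, (i < p.1)%N -> inner w (p.2 i) = 0 & P p.1 w].
  have [/H[w wP]|no] := pselect (orthonormal_upto p.1 p.2); first by exists w.
  by exists 0.
(* [E n] holds the first [n] chosen vectors, padded with [0]; entries below [n] no longer change, so
   the diagonal gives the sequence. *)
pose fix E n := if n is m.+1 then
  (fun i => if i == m then F (m, E m) else E m i) else (fun=> 0 : V).
have EO n : orthonormal_upto n (E n).
  elim: n => [|n IH]; first by move=> i j; rewrite ltn0.
  by have [/= w1 wO _] := FP (n, E n) IH; exact: orthonormal_rcons.
have EE n i : (i < n)%N -> E n i = F (i, E i).
  elim: n => // n IH; rewrite ltnS /= => ni; case: eqVneq => [->//|iN].
  by apply: IH; rewrite ltn_neqAle iN.
exists (fun n => F (n, E n)); split=> [n i j ni nj|n].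
  by rewrite -!(EE n) //; exact: EO.
by have [] := FP (n, E n) (EO n).
Qed.

End Orthonormal.

(** * Quadratic equations and Hermitian quadratic forms *)

Lemma quadratic_root (R : realType) (A B D : R) : A < 0 -> 0 <= D ->
  exists x, A * x ^+ 2 + 2 * B * x + D = 0.
Proof.
move=> A0 D0; pose s := Num.sqrt (B ^+ 2 - A * D).
have s2 : s ^+ 2 = B ^+ 2 - A * D by rewrite sqr_sqrtr; nra.
exists ((- B - s) / A).
have -> : A * ((- B - s) / A) ^+ 2 + 2 * B * ((- B - s) / A) + D =
  (s ^+ 2 - B ^+ 2 + A * D) / A by field; rewrite lt_eqF.
by rewrite s2; field; rewrite lt_eqF.
Qed.

Section QuadraticForm.
Variables (R : realType) (V : hilbertType R) (Q : V -> V -> R[i]).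
Hypothesis QS : is_sesquilinear Q.
Hypothesis QH : forall u v, Q u v = (Q v u)^*%C.

Lemma sesqDl u u' v : Q (u + u') v = Q u v + Q u' v.
Proof. by rewrite -[u]scale1r QS.1 mul1r scale1r. Qed.

Lemma sesqDr u v v' : Q u (v + v') = Q u v + Q u v'.
Proof. by rewrite -[v]scale1r QS.2 conjc1 mul1r scale1r. Qed.

Lemma sesq0l v : Q 0 v = 0.
Proof. by apply: (addIr (Q 0 v)); rewrite -sesqDl !add0r. Qed.

Lemma sesq0r u : Q u 0 = 0.
Proof. by apply: (addIr (Q u 0)); rewrite -sesqDr !add0r. Qed.

Lemma sesqZl c u v : Q (c *: u) v = c * Q u v.
Proof. by rewrite -[_ *: _]addr0 QS.1 sesq0l addr0. Qed.

Lemma sesqBl u u' v : Q (u - u') v = Q u v - Q u' v.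
Proof. by rewrite sesqDl -scaleN1r sesqZl mulN1r. Qed.

Lemma sesqZr c u v : Q u (c *: v) = c^*%C * Q u v.
Proof. by rewrite -[_ *: _]addr0 QS.2 sesq0r addr0. Qed.

(** Under [QH] the value [Q u u] is real, so the real part only moves it to [R]. *)
Definition quad u : R := complex.Re (Q u u).

Lemma quadD u v : quad (u + v) = quad u + quad v + 2 * complex.Re (Q u v).
Proof.
by rewrite /quad sesqDl !sesqDr [Q v u]QH !cReD cReJ; ring.
Qed.

Lemma quadZ c u : quad (c *: u) = nm c ^+ 2 * quad u.
Proof. by rewrite /quad sesqZl sesqZr mulrA [c * _]mulrC mulcJ cReMr. Qed.

End QuadraticForm.

(** * Coercivity modulo finitely many vectors of [V] *)

Section Definiteness.
Variables (R : realType) (V H : hilbertType R) (j : {linear V -> H}).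
Variables (Q : V -> V -> R[i]) (M Mj k : R).
Hypothesis QS : is_sesquilinear Q.
Hypothesis QH : forall u v, Q u v = (Q v u)^*%C.
Hypothesis QM : forall u v, nm (Q u v) <= M * nm u * nm v.
Hypothesis jM : forall u, nm (j u) <= Mj * nm u.
Hypothesis k0 : 0 <= k.
Implicit Types (u v w : V) (e : nat -> V).

Local Notation q := (quad Q).

Lemma quad_le u : `|q u| <= M * nm u ^+ 2.
Proof.
apply: le_trans (abs_Re_le _) _; apply: le_trans (QM _ _) _.
by rewrite expr2 mulrA.
Qed.

Lemma definite_on_orthogonal :
  ~ (exists e, (forall n, orthonormal_upto n e) /\
       forall n, `|q (e n)| <= n.+1%:R^-1 /\ k * nm (j (e n)) ^+ 2 <= n.+1%:R^-1) ->
  exists n e (sg eps : R),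
    [/\ orthonormal_upto n e, sg = 1 \/ sg = -1, 0 < eps &
     forall w, nm w = 1 -> (forall i, (i < n)%N -> inner w (e i) = 0) ->
       k * nm (j w) ^+ 2 <= eps -> eps <= sg * q w].
Proof.
move=> noseq.
have [n [e [eps [eO e0 eP]]]] : exists n e (eps : R),
    [/\ orthonormal_upto n e, 0 < eps & forall w, nm w = 1 ->
      (forall i, (i < n)%N -> inner w (e i) = 0) ->
      `|q w| <= eps -> k * nm (j w) ^+ 2 <= eps -> False].
  apply: contrapT => no; apply: noseq.
  apply: (@orthonormal_sequence _ _ (fun n w => `|q w| <= n.+1%:R^-1 /\
      k * nm (j w) ^+ 2 <= n.+1%:R^-1)) => n e eO.
  apply: contrapT => now; apply: no; exists n, e, n.+1%:R^-1.
  split=> // w w1 wO qw jw.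
  by apply: now; exists w.
(* If such a [u] exists, it joins the family and the sign is [-1]; otherwise the sign is [1]. The
   threshold [eps / 2] leaves room for a combination of two vectors below. *)
have [[u [u1 uO uj qu]]|nou] := pselect (exists u, [/\ nm u = 1,
    forall i, (i < n)%N -> inner u (e i) = 0,
    k * nm (j u) ^+ 2 <= eps / 2 & q u < 0]); last first.
  exists n, e, 1, (eps / 2); split=> //; [by left|by rewrite divr_gt0|].
  move=> w w1 wO wj; rewrite mul1r leNgt; apply/negP => qw.
  have [q0|q0] := ltP (q w) 0; first by apply: nou; exists w.
  by apply: (eP w w1 wO); rewrite ?ger0_norm //; lra.
exists n.+1, (fun i => if i == n then u else e i), (-1), (eps / 2).
split; [exact: orthonormal_rcons|by right|by rewrite divr_gt0|].
move=> v v1 vO vj; rewrite mulN1r.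
have vu : inner v u = 0 by have := vO n (ltnSn n); rewrite eqxx.
have {}vO i : (i < n)%N -> inner v (e i) = 0.
  by move=> ni; have := vO i (leqW ni); rewrite (ltn_eqF ni).
have [q0|q0] := ltP (q v) 0.
  rewrite leNgt; apply/negP => qv; apply: (eP v v1 vO); last lra.
  by rewrite ltr0_norm //; lra.
exfalso.
(* Along [x%:C *: u + v] with real [x], [q] is a quadratic polynomial with leading coefficient
   [q u < 0] and constant term [q v >= 0]. Its root gives a vector that, once normalised,
   contradicts [eP]. *)
have [x xP] := quadratic_root (complex.Re (Q u v)) qu q0.
pose w := x%:C *: u + v.
have qw : q w = 0.
  by rewrite quadD // quadZ // nmR real_normK ?num_real // sesqZl // cReMr -xP; ring.
have nw : nm w ^+ 2 = x ^+ 2 + 1.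
  rewrite nm_sqrD nmZ nmR u1 v1 innerZl innerC vu conjc0 mulr0 /= mulr0.
  by rewrite mulr1 real_normK ?num_real // expr1n addr0.
have nw0 : 0 < nm w.
  rewrite lt_neqAle nm_ge0 andbT eq_sym; apply/eqP => nw0.
  by move: nw; rewrite nw0; have := sqr_ge0 x; nra.
have nw1 : nm ((nm w)^-1%:C *: w) = 1.
  by rewrite nmZ nmR gtr0_norm ?invr_gt0 // mulVf // gt_eqF.
have wj : k * nm (j w) ^+ 2 <= eps * nm w ^+ 2.
  have jw : nm (j w) <= `|x| * nm (j u) + nm (j v).
    rewrite /w linearD linearZ; apply: le_trans (nmD _ _) _.
    by rewrite nmZ nmR.
  have jw2 : nm (j w) ^+ 2 <= (x ^+ 2 + 1) * (nm (j u) ^+ 2 + nm (j v) ^+ 2).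
    have : nm (j w) ^+ 2 <= (`|x| * nm (j u) + nm (j v)) ^+ 2.
      by rewrite ler_pXn2r ?nnegrE ?addr_ge0 ?mulr_ge0 ?nm_ge0.
    rewrite -(real_normK (num_real x)).
    by have := sqr_ge0 (nm (j u) - `|x| * nm (j v)); nra.
  have := ler_wpM2l k0 jw2; rewrite nw; have := sqr_ge0 x; nra.
apply: (eP _ nw1).
- by move=> i ni; rewrite innerZl innerDl innerZl uO // vO // mulr0 addr0 mulr0.
- by rewrite quadZ // qw mulr0 normr0 ltW.
- rewrite linearZ nmZ nmR gtr0_norm ?invr_gt0 // exprMn mulrCA exprVn.
  by rewrite ler_pdivrMl ?exprn_gt0 // [_ * eps]mulrC.
Qed.

(** If [k |j w|^2 <= eps |w|^2], this is [definite_on_orthogonal] after normalisation. Otherwise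
    [K = (|M| + eps) / eps] makes the last term exceed [(|M| + eps) |w|^2], which absorbs
    [sg * q w >= - |M| |w|^2]. *)
Lemma coercive_on_orthogonal :
  ~ (exists e, (forall n, orthonormal_upto n e) /\
       forall n, `|q (e n)| <= n.+1%:R^-1 /\ k * nm (j (e n)) ^+ 2 <= n.+1%:R^-1) ->
  exists n e (sg eps K : R),
    [/\ orthonormal_upto n e, sg = 1 \/ sg = -1, 0 < eps, 0 <= K &
     forall w, (forall i, (i < n)%N -> inner w (e i) = 0) ->
       eps * nm w ^+ 2 <= sg * q w + K * (k * nm (j w) ^+ 2)].
Proof.
move=> /definite_on_orthogonal[n [e [sg [eps [eO sgP e0 eP]]]]].
have K0 : 0 <= (`|M| + eps) / eps by rewrite divr_ge0 ?addr_ge0 // ltW.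
exists n, e, sg, eps, ((`|M| + eps) / eps); split=> // w wO.
have [->|w0] := eqVneq w 0.
  by rewrite linear0 !nm0 /quad sesq0l // expr0n /= !mulr0 addr0.
have nw := nm_gt0 w0; pose t := (nm w)^-1.
have t0 : 0 < t by rewrite invr_gt0.
have tw : t * nm w = 1 by rewrite mulVf // gt_eqF.
have tw1 : nm (t%:C *: w) = 1 by rewrite nmZ nmR gtr0_norm.
have twO i : (i < n)%N -> inner (t%:C *: w) (e i) = 0.
  by move=> ni; rewrite innerZl wO // mulr0.
have := eP _ tw1 twO.
rewrite quadZ // linearZ nmZ nmR gtr0_norm // => h.
have -> : nm w ^+ 2 = 1 * nm w ^+ 2 by rewrite mul1r.
have [kw|kw] := leP (k * nm (j w) ^+ 2) (eps * nm w ^+ 2).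
  have {}h : eps <= sg * (t ^+ 2 * q w).
    apply: h; rewrite exprMn mulrCA.
    have -> : eps = t ^+ 2 * (eps * nm w ^+ 2) by rewrite mulrCA -exprMn tw expr1n mulr1.
    by rewrite ler_pM2l // exprn_gt0.
  have : eps * nm w ^+ 2 <= sg * q w.
    have -> : sg * q w = sg * (t ^+ 2 * q w) * nm w ^+ 2.
      by rewrite -mulrA [_ * nm w ^+ 2]mulrAC -exprMn tw expr1n mul1r.
    by rewrite ler_pM2r // exprn_gt0.
  have : 0 <= (`|M| + eps) / eps * (k * nm (j w) ^+ 2).
    by rewrite mulr_ge0 // mulr_ge0 ?sqr_ge0.
  by rewrite mul1r; lra.
have hq : - (sg * q w) <= `|M| * nm w ^+ 2.
  have : `|q w| <= `|M| * nm w ^+ 2.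
    by apply: le_trans (quad_le w) _; rewrite ler_pM2r ?exprn_gt0 ?ler_norm.
  by rewrite ler_norml; case: sgP => -> /andP[]; lra.
have : (`|M| + eps) * nm w ^+ 2 <= (`|M| + eps) / eps * (k * nm (j w) ^+ 2).
  rewrite -mulrA ler_wpM2l ?addr_ge0 ?(ltW e0) //.
  by rewrite ler_pdivlMl // ltW.
by rewrite mul1r; lra.
Qed.

Lemma coercive_finite_codim :
  ~ (exists e, (forall n, orthonormal_upto n e) /\
       forall n, `|q (e n)| <= n.+1%:R^-1 /\ k * nm (j (e n)) ^+ 2 <= n.+1%:R^-1) ->
  exists n e (sg alpha C K : R),
    [/\ sg = 1 \/ sg = -1, 0 < alpha, 0 <= C, 0 <= K &
     forall u, alpha * nm u ^+ 2 <= sg * q u +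
       C * \sum_(i < n) nm (inner u (e i)) ^+ 2 + K * (k * nm (j u) ^+ 2)].
Proof.
move=> /coercive_on_orthogonal[n [e [sg [eps [K [eO sgP e0 K0 eP]]]]]].
pose M' := `|M|; have M0 : 0 <= M' := normr_ge0 M.
(* With [u = w + p], where [p] is the projection of [u] on the family, the four summands pay for the
   [|p|^2] arising from [|u|^2], from [q p], from Young's inequality on the cross term (at the cost
   of [eps / 2 * |w|^2]), and from [|j w|^2 <= 2 |j u|^2 + 2 Mj^2 |p|^2]. *)
pose C := eps / 2 + M' + 2 * M' ^+ 2 / eps + 2 * K * k * Mj ^+ 2.
exists n, e, sg, (eps / 2), C, (2 * K).
split=> //; [by rewrite divr_gt0| |by rewrite mulr_ge0|].
  have h1 : 0 <= 2 * M' ^+ 2 / eps by rewrite divr_ge0 ?(ltW e0) // mulr_ge0 ?sqr_ge0.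
  have h2 : 0 <= 2 * K * k * Mj ^+ 2 by rewrite mulr_ge0 ?sqr_ge0 // !mulr_ge0.
  by rewrite /C; lra.
move=> u; have [<- nu] := nm_proj_on u eO.
set p := proj_on n e u in nu *; pose w := u - p.
have wE : u = w + p by rewrite subrK.
have hw := eP w (proj_on_orth u eO).
have qu : q u = q w + q p + 2 * complex.Re (Q w p) by rewrite {1}wE quadD.
have ler_M' x : 0 <= x -> M * x <= M' * x.
  by move=> x0; rewrite ler_wpM2r // ler_norm.
have hqp : `|q p| <= M' * nm p ^+ 2.
  by apply: le_trans (quad_le p) _; rewrite ler_M' ?sqr_ge0.
have hQ : `|complex.Re (Q w p)| <= M' * (nm w * nm p).
  apply: le_trans (abs_Re_le _) _; apply: le_trans (QM _ _) _.
  by rewrite -mulrA ler_M' ?mulr_ge0 ?nm_ge0.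
have hjw : nm (j w) ^+ 2 <= 2 * nm (j u) ^+ 2 + 2 * (Mj ^+ 2 * nm p ^+ 2).
  have h1 : nm (j w) <= nm (j u) + nm (j p).
    by rewrite /w linearB -(nmN (j p)) nmD.
  have h2 := jM p; have := nm_ge0 (j w); have := nm_ge0 (j p); have := nm_ge0 (j u).
  move: (nm (j w)) (nm (j u)) (nm (j p)) h1 h2 => a b c h1 h2 b0 c0 a0.
  have : a ^+ 2 <= (b + c) ^+ 2 by rewrite ler_pXn2r ?nnegrE ?addr_ge0.
  have : c ^+ 2 <= (Mj * nm p) ^+ 2 by rewrite ler_pXn2r ?nnegrE // (le_trans c0).
  rewrite exprMn; have := sqr_ge0 (b - c); nra.
have amgm : 2 * (M' * (nm w * nm p)) <= eps / 2 * nm w ^+ 2 + 2 * M' ^+ 2 / eps * nm p ^+ 2.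
  have : 0 <= (eps * nm w - 2 * M' * nm p) ^+ 2 / (2 * eps).
    by rewrite divr_ge0 ?sqr_ge0 // mulr_ge0 ?ltW.
  have -> : (eps * nm w - 2 * M' * nm p) ^+ 2 / (2 * eps) = eps / 2 * nm w ^+ 2 +
     2 * M' ^+ 2 / eps * nm p ^+ 2 - 2 * (M' * (nm w * nm p)).
    by field; rewrite gt_eqF.
  lra.
have {}hjw := ler_wpM2l (mulr_ge0 K0 k0) hjw.
rewrite nu qu -/w /C.
move: hqp hQ hw hjw amgm; rewrite !ler_norml.
move: (2 * M' ^+ 2 / eps) => Z.
move: (nm w ^+ 2) (nm p ^+ 2) (M' * (nm w * nm p)) => w2 p2 wp.
by case: sgP => ->; lra.
Qed.

End Definiteness.

(** * Replacing functionals on [V] by vectors of [H] *)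

Section Density.
Variables (R : realType) (V H : hilbertType R) (j : {linear V -> H}) (Mj : R).
Hypothesis j_inj : injective j.
Hypothesis jM : forall u, nm (j u) <= Mj * nm u.

(* The functionals [u |-> inner (j u) y] are norm dense in the dual of [V]. *)
Lemma functional_approx v (d : R) : 0 < d ->
  exists y, forall u, nm (inner u v - inner (j u) y) <= d * nm u.
Proof.
move=> d0.
pose S := [set t : V | exists y, forall u, inner (j u) y = inner u t].
have [|z [zO zP]] := @projection _ _ S v.
  split; first by exists 0 => u; rewrite !inner0r.
  move=> c x x' [y yP] [y' yP']; exists (c *: y + y') => u.
  by rewrite !innerDr !innerZr yP yP'.
(* The Riesz representative [t] of [u |-> inner (j u) (j z)] lies in [S], so
   [|j z|^2 = inner z t = 0], and [j] is injective. *)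
have z0 : z = 0.
  have [t tP] : exists t, forall u, inner (j u) (j z) = inner u t.
    apply: (@riesz _ _ (fun u => inner (j u) (j z)) (Mj * nm (j z))) => [c x y|x].
      by rewrite linearD linearZ innerDl innerZl.
    apply: le_trans (cauchy_schwarz _ _) _.
    by rewrite mulrAC ler_wpM2r ?nm_ge0.
  apply: j_inj; rewrite linear0; apply: inner_eq0 => w.
  suff -> : j z = 0 by rewrite inner0l.
  apply/nm_eq0/eqP; rewrite -sqrf_eq0; apply/eqP/complexI.
  by rewrite -innerxx tP zO //; exists (j z).
have [t [y yP]] := zP _ d0; rewrite z0 subr0 => vt.
exists y => u; rewrite yP -innerBr; apply: le_trans (cauchy_schwarz _ _) _.
by rewrite mulrC ler_wpM2r ?nm_ge0 ?ltW.
Qed.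

Variables (Q : V -> V -> R[i]) (M k : R).
Hypothesis QS : is_sesquilinear Q.
Hypothesis QH : forall u v, Q u v = (Q v u)^*%C.
Hypothesis QM : forall u v, nm (Q u v) <= M * nm u * nm v.
Hypothesis k0 : 0 <= k.

Lemma coercive_finite_rank :
  ~ (exists e, (forall n, orthonormal_upto n e) /\
       forall n, `|quad Q (e n)| <= n.+1%:R^-1 /\ k * nm (j (e n)) ^+ 2 <= n.+1%:R^-1) ->
  exists n (y : nat -> H) (sg alpha C K : R),
    [/\ sg = 1 \/ sg = -1, 0 < alpha, 0 <= C, 0 <= K &
     forall u, alpha * nm u ^+ 2 <= sg * quad Q u +
       C * \sum_(i < n) nm (inner (j u) (y i)) ^+ 2 + K * (k * nm (j u) ^+ 2)].
Proof.
move=> /(coercive_finite_codim QS QH QM jM k0).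
move=> [n [e [sg [alpha [C [K [sgP a0 C0 K0 eP]]]]]]].
(* The approximation errors add up to at most [C * n * 2 d^2 |u|^2], and this [d] keeps them below
   [alpha / 2 * |u|^2]; the [+ 1] keeps the denominator positive. *)
pose d := Num.sqrt (alpha / (4 * (C * n%:R + 1))).
have Cn : 0 < C * n%:R + 1 by rewrite ltr_wpDl ?mulr_ge0.
have d20 : 0 < alpha / (4 * (C * n%:R + 1)) by rewrite divr_gt0 ?mulr_gt0.
have d2 : d ^+ 2 = alpha / (4 * (C * n%:R + 1)) by rewrite sqr_sqrtr ?ltW.
have d0 : 0 < d by rewrite sqrtr_gt0.
have /choice[y yP] i := functional_approx (e i) d0.
exists n, y, sg, (alpha / 2), (2 * C), K; split=> //.
- by rewrite divr_gt0.
- by rewrite mulr_ge0.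
move=> u; have := eP u.
have hs : \sum_(i < n) nm (inner u (e i)) ^+ 2 <=
    2 * \sum_(i < n) nm (inner (j u) (y i)) ^+ 2 + n%:R * (2 * d ^+ 2 * nm u ^+ 2).
  have -> : n%:R * (2 * d ^+ 2 * nm u ^+ 2) = \sum_(i < n) (2 * d ^+ 2 * nm u ^+ 2).
    by rewrite sumr_const card_ord mulr_natl.
  rewrite mulr_sumr -big_split /=; apply: ler_sum => i _.
  have h1 := yP i u.
  have := nmD (inner u (e i) - inner (j u) (y i)) (inner (j u) (y i)).
  rewrite subrK; have := nm_ge0 (inner u (e i)).
  have := nm_ge0 (inner u (e i) - inner (j u) (y i)); move: h1.
  move: (nm (inner u (e i) - _)) (nm (inner u (e i))) (nm (inner (j u) _)) => a b c.
  move=> h1 a1 b1 h2.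
  have : b ^+ 2 <= (a + c) ^+ 2 by rewrite ler_pXn2r ?nnegrE // (le_trans b1).
  have : a ^+ 2 <= (d * nm u) ^+ 2 by rewrite ler_pXn2r ?nnegrE // (le_trans a1).
  by rewrite exprMn; have := sqr_ge0 (a - c); nra.
have h3 : C * (n%:R * (2 * d ^+ 2 * nm u ^+ 2)) <= alpha / 2 * nm u ^+ 2.
  have -> : alpha / 2 = (C * n%:R + 1) * (2 * d ^+ 2).
    by rewrite d2; field; rewrite gt_eqF.
  by have := mulr_ge0 (sqr_ge0 d) (sqr_ge0 (nm u)); nra.
have := ler_wpM2l C0 hs; nra.
Qed.

End Density.

(** * Essential coercivity along orthonormal sequences *)

Section EssentialCoercivity.
Variables (R : realType) (V H : hilbertType R).

Lemma orthonormal_weak_cvg0 (e : nat -> V) :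
  (forall n, orthonormal_upto n e) -> weak_cvg e 0.
Proof.
move=> eO phi /linear_nm_bounded[M phiM].
have [c x y|z zP] := @riesz _ _ phi M _ phiM; first by rewrite linearP.
apply/cvgrPdist_lt => _ /gt0_complex[d d0 ->].
have [N HN] := bessel_cvg0 z eO d0.
exists N => // n /= nN; rewrite linear0 sub0r normrN norm_lt zP innerC nmJ.
exact: HN.
Qed.

(** As [a u u] is real, the shifted form has real part [quad Q u] and imaginary part
    [- Im lambda * |j u|^2] on the diagonal. Along such a sequence both tend to [0], while the norms
    stay equal to [1]. *)
Lemma essentially_coercive_no_sequence (j : {linear V -> H})
    (a : {sesquilinear V -> R[i]}) (lambda : R[i]) :
  is_symmetric_form a -> essentially_coercive (shifted_form j a lambda) ->
  let Q u v := a u v - (complex.Re lambda)%:C * inner (j u) (j v) in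
  ~ (exists e, (forall n, orthonormal_upto n e) /\
       forall n, `|quad Q (e n)| <= n.+1%:R^-1 /\
         `|complex.Im lambda| * nm (j (e n)) ^+ 2 <= n.+1%:R^-1).
Proof.
move=> a_sym a_ess Q [e [eO eP]].
have e1 n : nm (e n) = 1.
  have := eO n.+1 n n (ltnSn n) (ltnSn n); rewrite innerxx eqxx => /complexI/eqP.
  by rewrite sqrf_eq1 => /orP[] /eqP // h; have := nm_ge0 (e n); rewrite h; lra.
have bE u : shifted_form j a lambda u u =
    (quad Q u)%:C - 'i%C * (complex.Im lambda * nm (j u) ^+ 2)%:C.
  have : complex.Im (a u u) = 0.
    have := a_sym u u; case: (a u u) => x y /(congr1 (@complex.Im R)) /=; lra.
  rewrite /shifted_form /quad /Q innerxx; move: (lambda) (a u u) => [lx ly] [x y] /= ->.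
  by apply/eqP; rewrite eq_complex /=; apply/andP; split; apply/eqP; ring.
have := a_ess e (orthonormal_weak_cvg0 eO).
have b0 : (shifted_form j a lambda (e n) (e n) : R[i]^o) @[n --> \oo] --> (0 : R[i]^o).
  apply/cvgrPdist_lt => _ /gt0_complex[d d0 ->].
  have [N HN] := natSinv_lt (divr_gt0 d0 (ltr0Sn R 1)).
  exists N => // n /= nN; rewrite sub0r normrN norm_lt bE.
  apply: le_lt_trans (nmD _ _) _; rewrite nmN nmM !nmR normrM.
  rewrite (_ : nm 'i%C = 1) ?mul1r; last first.
    by rewrite /nm normc_def /= expr0n expr1n add0r sqrtr1.
  rewrite [X in _ * X]ger0_norm ?sqr_ge0 //.
  have [h1 h2] := eP n; move: h1 h2 (HN _ nN); move: (n.+1%:R^-1) => t; lra.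
move=> /(_ b0) /cvgrPdist_lt /(_ 1%:C); rewrite ltcR ltr01 => /(_ isT) [N _].
move=> /(_ N (leqnn N)) /=; rewrite sub0r normrN normr_id norm_lt e1; lra.
Qed.

End EssentialCoercivity.

(** * Finite-dimensional subspaces and dense subsets *)

Section FiniteDimension.
Variables (R : realType) (H : hilbertType R).

(** [finite_dim] asks for spanning vectors inside [S], whereas the [w i] may lie outside. By
    induction on [n]: one [s] in [S] with nonzero last coefficient, if there is any, serves to
    cancel the last coefficient of all other vectors. *)
Lemma finite_dim_span n (w : nat -> H) (S : set H) : is_subspace S ->
  (forall x, S x -> exists c : nat -> R[i], x = \sum_(i < n) c i *: w i) ->
  finite_dim S.
Proof.
elim: n S => [|n IH] S [S0 SL] Sw.
  exists 0, (fun=> 0); split=> // x /Sw[c ->].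
  by exists (fun=> 0); rewrite !big_ord0.
pose S' := [set x | S x /\ exists c : nat -> R[i], x = \sum_(i < n) c i *: w i].
have S'P : is_subspace S'.
  split.
    by split=> //; exists (fun=> 0); rewrite big1 // => i _; rewrite scale0r.
  move=> k x x' [Sx [c xc]] [Sx' [c' xc']]; split; first exact: SL.
  exists (fun i => k * c i + c' i); rewrite xc xc' scaler_sumr -big_split /=.
  by apply: eq_bigr => i _; rewrite scalerDl scalerA.
have [m [e [eS' eP]]] : finite_dim S' by apply: IH => // x [].
have [[s [Ss [c [sc cn]]]]|nos] := pselect (exists s, S s /\
    exists c : nat -> R[i], s = \sum_(i < n.+1) c i *: w i /\ c n != 0).
  exists m.+1, (fun i => if unlift ord0 i is Some i' then e i' else s); split.
    by move=> i; case: (unlift ord0 i) => // i'; have [] := eS' i'.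
  move=> x Sx; have [d xd] := Sw _ Sx.
  have [|b bP] := eP (x - (d n / c n) *: s).
    split; first by rewrite addrC -scaleNr; exact: SL.
    exists (fun i => d i - d n / c n * c i).
    rewrite xd sc !big_ord_recr /= scalerDr scalerA divfK // opprD addrACA subrr addr0.
    rewrite scaler_sumr -sumrB.
    by apply: eq_bigr => i _; rewrite scalerBl scalerA.
  exists (fun i => if unlift ord0 i is Some i' then b i' else d n / c n).
  rewrite big_ord_recl unlift_none.
  under eq_bigr => i _ do rewrite liftK.
  by rewrite -bP addrC subrK.
exists m, e; split=> [i|x Sx]; first by have [] := eS' i.
apply: eP; split=> //; have [d xd] := Sw _ Sx.
exists d; rewrite xd big_ord_recr /=.
have [->|dn] := eqVneq (d n) 0; first by rewrite scale0r addr0.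
by exfalso; apply: nos; exists x; split=> //; exists d.
Qed.

Lemma dense_of_approx (S : set H) :
  (forall x (e : R), 0 < e -> exists2 s, S s & nm (x - s) < e) -> dense S.
Proof.
move=> SP O [x Ox] Oo; have /nbhs_ballP[_ /= /gt0_complex[r r0 ->] rO] :
  nbhs x O by exact: open_nbhs_nbhs.
have [s Ss xs] := SP x _ r0; exists s; split=> //; apply: rO.
by rewrite -ball_normE /= norm_lt.
Qed.

Lemma dense_orthogonal (S : set H) z :
  dense S -> (forall s, S s -> inner z s = 0) -> z = 0.
Proof.
move=> Sd zS; apply/nm_eq0/eqP; rewrite eq_le nm_ge0 andbT.
apply/ler_addgt0Pr => e e0; rewrite add0r.
have [|s [zs Ss]] := Sd (ball z e%:C) _ (ball_open _ _).
  by exists z; apply: ballxx; rewrite ltcR.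
move: zs; rewrite -ball_normE /= norm_lt => zs.
have [->|z0] := eqVneq z 0; first by rewrite nm0 ltW.
rewrite -(ler_pM2l (nm_gt0 z0)) -expr2.
have -> : nm z ^+ 2 = complex.Re (inner z (z - s)).
  by rewrite innerBr innerxx zS // subr0.
by apply: le_trans (Re_inner_le _ _) _; rewrite ler_pM2l ?nm_gt0 ?ltW.
Qed.

End FiniteDimension.

(** * Finite rank operators *)

Section FiniteRank.
Variables (R : realType) (H : hilbertType R) (n : nat) (y : nat -> H).

(** Its quadratic form is the sum of squares in [coercive_finite_rank]. *)
Definition finite_rank (x : H) := \sum_(i < n) inner x (y i) *: y i.

Lemma finite_rankP k x x' :
  finite_rank (k *: x + x') = k *: finite_rank x + finite_rank x'.
Proof.
rewrite /finite_rank scaler_sumr -big_split /=; apply: eq_bigr => i _.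
by rewrite innerDl innerZl scalerDl scalerA.
Qed.

Lemma finite_rank_inner x :
  inner (finite_rank x) x = (\sum_(i < n) nm (inner x (y i)) ^+ 2)%:C.
Proof.
rewrite inner_suml rmorph_sum /=; apply: eq_bigr => i _.
by rewrite innerZl [inner (y i) x]innerC mulrC mulcJ.
Qed.

Lemma sum_inner_le x : \sum_(i < n) nm (inner x (y i)) ^+ 2 <=
  (\sum_(i < n) nm (y i) ^+ 2) * nm x ^+ 2.
Proof.
rewrite mulr_suml; apply: ler_sum => i _; rewrite mulrC -exprMn.
by rewrite ler_pXn2r ?nnegrE ?mulr_ge0 ?nm_ge0 // cauchy_schwarz.
Qed.

Lemma finite_rank_le x :
  nm (finite_rank x) <= (\sum_(i < n) nm (y i) ^+ 2) * nm x.
Proof.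
have -> : (\sum_(i < n) nm (y i) ^+ 2) * nm x = \sum_(i < n) nm x * nm (y i) * nm (y i).
  by rewrite mulr_suml; apply: eq_bigr => i _; rewrite -mulrA mulrC expr2.
rewrite /finite_rank; elim/big_ind2: _ => [|p q r s pq rs|i _]; first by rewrite nm0.
  by apply: le_trans (nmD _ _) _; exact: lerD.
by rewrite nmZ ler_wpM2r ?nm_ge0 ?cauchy_schwarz.
Qed.

End FiniteRank.

(** * The associated operator and its finite rank perturbations *)

Section AssociatedOperator.
Variables (R : realType) (V H : hilbertType R) (j : {linear V -> H}).
Variables (a : {sesquilinear V -> R[i]}) (M Mj : R).
Hypothesis aM : forall u v, nm (a u v) <= M * nm u * nm v.
Hypothesis jM : forall u, nm (j u) <= Mj * nm u.
Hypothesis j_inj : injective j.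
Hypothesis j_dense : dense (range j).
Hypothesis a_sym : is_symmetric_form a.

Local Notation A := (associated_operator j a).

Lemma form_is_sesquilinear : is_sesquilinear a.
Proof.
split=> [k u u' v|k u v v']; first by rewrite linearDl linearZl_LR.
by rewrite linearDr linearZr_LR.
Qed.

Lemma form_sym u v : a u v = (a v u)^*%C. Proof. exact: a_sym. Qed.

Lemma range_orth z : (forall v, inner z (j v) = 0) -> z = 0.
Proof. by move=> zj; apply: (dense_orthogonal j_dense) => _ [v _ <-]. Qed.

Lemma associated_is_operator : is_operator A.
Proof.
split.
- by exists 0 => [|v] /=; rewrite ?linear0 // linear0l inner0l.
- move=> c p q [u pu up] [u' qu uq]; exists (c *: u + u') => [|v] /=.
    by rewrite pu qu linearP.
  by rewrite form_is_sesquilinear.1 up uq innerDl innerZl.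
- move=> x y z [u /= xu uy] [u' /= xu' uz']; apply/eqP; rewrite -subr_eq0; apply/eqP.
  apply: range_orth => v; rewrite innerBl -uy -uz'.
  by rewrite (_ : u' = u) ?subrr //; apply: j_inj; rewrite -xu -xu'.
Qed.

(** The form of [theta (A - mu) + C B], with [B] the operator [finite_rank n y]; the factor [theta]
    adjusts the sign or, for nonreal [mu], the argument. *)
Definition perturbed (theta mu : R[i]) (C : R) n (y : nat -> H) u v :=
  theta * (a u v - mu * inner (j u) (j v)) +
  C%:C * inner (finite_rank n y (j u)) (j v).

Lemma perturbed_sesquilinear theta mu C n y :
  is_sesquilinear (perturbed theta mu C n y).
Proof.
have [al ar] := form_is_sesquilinear.
split=> k u u' v; rewrite /perturbed (linearP j).
  rewrite al finite_rankP !innerDl !innerZl. by ring.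
by rewrite ar !innerDr !innerZr; ring.
Qed.

Lemma perturbed_bounded theta mu C n y : exists L : R, forall u v,
  nm (perturbed theta mu C n y u v) <= L * nm u * nm v.
Proof.
pose b := \sum_(i < n) nm (y i) ^+ 2.
have b0 : 0 <= b by apply: sumr_ge0 => i _; exact: sqr_ge0.
exists (nm theta * (M + nm mu * Mj ^+ 2) + nm C%:C * (b * Mj ^+ 2)) => u v.
have jj : nm (j u) * nm (j v) <= Mj ^+ 2 * (nm u * nm v).
  by rewrite expr2 mulrACA ler_pM ?nm_ge0.
apply: le_trans (nmD _ _) _; rewrite !nmM -mulrA mulrDl lerD //.
  rewrite -mulrA ler_wpM2l ?nm_ge0 //; apply: le_trans (nmD _ _) _.
  rewrite nmN nmM mulrDl mulrA lerD // -mulrA ler_wpM2l ?nm_ge0 //.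
  exact: le_trans (cauchy_schwarz _ _) _.
rewrite -!mulrA ler_wpM2l ?nm_ge0 //; apply: le_trans (cauchy_schwarz _ _) _.
apply: (@le_trans _ _ (b * (nm (j u) * nm (j v)))).
  by rewrite mulrA ler_wpM2r ?nm_ge0 // finite_rank_le.
by apply: ler_wpM2l => //; rewrite [leRHS]mulrA -expr2.
Qed.

Section Coercive.
Variables (theta mu : R[i]) (C : R) (n : nat) (y : nat -> H) (alpha : R).
Hypothesis alpha_gt0 : 0 < alpha.
Hypothesis coer : forall u, alpha * nm u ^+ 2 <=
  complex.Re (theta * (a u u - mu * inner (j u) (j u))) +
  C * \sum_(i < n) nm (inner (j u) (y i)) ^+ 2.

Lemma perturbed_coercive u :
  alpha * nm u ^+ 2 <= complex.Re (perturbed theta mu C n y u u).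
Proof. by rewrite /perturbed finite_rank_inner cReD cReMr; exact: coer. Qed.

Lemma perturbed_solve f : exists u, forall v,
  perturbed theta mu C n y u v = inner f (j v).
Proof.
have [L LP] := perturbed_bounded theta mu C n y.
have [||u uP] := lax_milgram (phi := fun v => inner (j v) f)
  (L := Mj * nm f) (perturbed_sesquilinear theta mu C n y) LP alpha_gt0
  perturbed_coercive.
- by move=> k x x'; rewrite linearP innerDl innerZl.
- move=> x; apply: le_trans (cauchy_schwarz _ _) _.
  by rewrite mulrAC ler_wpM2r ?nm_ge0.
- by exists u => v; rewrite uP -innerC.
Qed.

Lemma perturbed_inj u : (forall v, perturbed theta mu C n y u v = 0) -> u = 0.
Proof. by move=> h; exact: coercive_eq0 alpha_gt0 (perturbed_coercive u) (h u). Qed.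

Hypothesis theta0 : theta != 0.

Lemma kernel_subspace : is_subspace (kernel_of (id_minus mu A)).
Proof.
split.
  exists (0, 0) => /=; last by rewrite scaler0 subr0.
  by exists 0 => [|v] /=; rewrite ?linear0 // linear0l inner0l.
have kP x : kernel_of (id_minus mu A) x <->
    exists2 u, x = j u & forall v, a u v = mu * inner (j u) (j v).
  split.
    move=> [[x' z] [u /= -> uz] [<- h]]; exists u => // v.
    by rewrite uz -innerZl; move/eqP: h; rewrite subr_eq0 => /eqP ->.
  move=> [u -> uP]; exists (j u, mu *: j u); last by rewrite /= subrr.
  by exists u => // v; rewrite uP innerZl.
move=> k x x' /kP[u -> uP] /kP[u' -> uP']; apply/kP.
exists (k *: u + u') => [|v]; first by rewrite linearP.
by rewrite form_is_sesquilinear.1 uP uP' linearP innerDl innerZl; ring.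
Qed.

(** The equation for [theta (A - mu) + C B] is uniquely solvable. On the kernel of [mu - A] only
    [C B] survives, so the kernel lies in the span of the solutions for the [y i]. Solving with an
    arbitrary right-hand side puts every vector in the range up to a combination of the [y i]. *)
Lemma fredholm_id_minus : fredholm (id_minus mu A).
Proof.
have pl := (perturbed_sesquilinear theta mu C n y).
split.
  have /choice[w wP] i := perturbed_solve (y i).
  apply: (finite_dim_span kernel_subspace (n := n) (w := fun i => j (w i))).
  move=> x [[x' z] [u /= -> uz] [<- h]].
  have uP v : a u v = mu * inner (j u) (j v).
    by rewrite uz -innerZl; move/eqP: h; rewrite subr_eq0 => /eqP ->.
  exists (fun i => C%:C * inner (j u) (y i)).
  suff uE : u = \sum_(i < n) (C%:C * inner (j u) (y i)) *: w i.
    by rewrite {1}uE linear_sum; apply: eq_bigr => i _; rewrite linearZ.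
  apply/eqP; rewrite -subr_eq0; apply/eqP/perturbed_inj => v.
  rewrite (sesqBl pl).
  rewrite (big_morph (fun u => perturbed theta mu C n y u v) (id1 := 0) (op1 := +%R));
    last first.
  - exact: sesq0l pl _.
  - by move=> ? ?; exact: sesqDl pl _ _ _.
  rewrite {1}/perturbed uP subrr mulr0 add0r inner_suml mulr_sumr -sumrB big1 // => i _.
  by rewrite (sesqZl pl) wP innerZl mulrA subrr.
exists n, (fun i => y i) => x.
(* With this right-hand side, [(mu - A) (j u) = x + theta^-1 C B], where [B] now denotes the value
   at [j u]; this dictates the coefficients below. *)
have [u uP] := perturbed_solve (- theta *: x).
pose B := finite_rank n y (j u).
exists (fun i => - (theta^-1 * C%:C) * inner (j u) (y i)).
exists (j u), (j u, mu *: j u + theta^-1 *: (- theta *: x - C%:C *: B)).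
  exists u => //= v; apply: (mulfI theta0).
  rewrite innerDl !innerZl innerBl !innerZl mulrDr mulrA mulrA divff // mul1r.
  have := uP v; rewrite /perturbed innerZl -/B => <-; ring.
congr (_, _) => /=.
rewrite opprD addNKr scalerBr opprB scalerA scalerA mulrN mulVf // scaleN1r opprK addrC.
congr (_ + _).
rewrite /B /finite_rank scaler_sumr -sumrN; apply: eq_bigr => i _.
by rewrite scalerA mulNr scaleNr opprK.
Qed.

End Coercive.

End AssociatedOperator.

(** * Selfadjointness and semiboundedness for elliptic forms *)

Section Elliptic.
Variables (R : realType) (V H : hilbertType R) (j : {linear V -> H}).
Variables (a : {sesquilinear V -> R[i]}) (M Mj : R).
Hypothesis aM : forall u v, nm (a u v) <= M * nm u * nm v.
Hypothesis jM : forall u, nm (j u) <= Mj * nm u.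
Hypothesis j_inj : injective j.
Hypothesis j_dense : dense (range j).
Hypothesis a_sym : is_symmetric_form a.

Local Notation A := (associated_operator j a).

Lemma form_diag u : a u u = (complex.Re (a u u))%:C.
Proof.
have := a_sym u u; case: (a u u) => x y /(congr1 (@complex.Im R)) /= h.
by apply/eqP; rewrite eq_complex /= eqxx /=; apply/eqP; lra.
Qed.

Lemma associated_symmetric p q : A p -> A q -> inner p.2 q.1 = inner p.1 q.2.
Proof.
by move=> [u pu up] [v qv vq]; rewrite qv -up (form_sym a_sym) vq -pu -innerC.
Qed.

Variables (sg omega alpha : R).
Hypothesis sgP : sg = 1 \/ sg = -1.
Hypothesis alpha_gt0 : 0 < alpha.
Hypothesis elliptic : forall u : V,
  alpha * nm u ^+ 2 <= sg * complex.Re (a u u) + omega * nm (j u) ^+ 2.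

Lemma sg_sqr : sg * sg = 1.
Proof. by case: sgP => ->; lra. Qed.

(** This is surjectivity of [sg A + omega], solved for [A x] by means of [sg * sg = 1]; it is
    Lax-Milgram with an empty finite rank term. *)
Lemma elliptic_range f :
  exists x, A (x, sg%:C *: f - (sg * omega)%:C *: x).
Proof.
have [u|u uP] := perturbed_solve (theta := sg%:C) (mu := (- (sg * omega))%:C)
  (C := 0) (n := 0) (y := fun=> 0) aM jM alpha_gt0 _ f.
  rewrite mul0r addr0 cReMr innerxx -rmorphM cReD cReN mulrDr /= mulNr opprK.
  by rewrite [sg * (_ * _)]mulrA mulrA sg_sqr mul1r.
exists (j u), u => // v /=.
rewrite innerBl !innerZl -uP /perturbed mul0r addr0 mulrA -rmorphM sg_sqr mul1r.
by rewrite rmorphN mulNr opprK addrK.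
Qed.

(** For [z] orthogonal to the domain, solve [(sg A + omega) (j u) = z]. Testing with [u] makes the
    right side of [elliptic] vanish, so [u = 0] and then [z = 0]. *)
Lemma elliptic_dense_domain : dense (domain A).
Proof.
have [A0 AL Af] := associated_is_operator a j_inj j_dense.
apply: dense_of_approx => x e e0.
have [|z [zO zP]] := @projection _ _ (domain A) x.
  split; first by exists 0.
  by move=> c p q [p' pA] [q' qA]; exists (c *: p' + q'); exact: (AL c _ _ pA qA).
suff z0 : z = 0.
  by have [s sA sx] := zP _ e0; exists s => //; rewrite -[x - s]subr0 -[0]z0.
have [_ [u /= -> uP]] := elliptic_range z.
have zu : inner z (j u) = 0.
  by apply: zO; exists (sg%:C *: z - (sg * omega)%:C *: j u); exists u.
have u0 : u = 0.
  have au : complex.Re (a u u) = - (sg * omega * nm (j u) ^+ 2).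
    by rewrite uP innerBl !innerZl zu mulr0 sub0r innerxx cReN cReMr.
  have := elliptic u; rewrite au mulrN [sg * (_ * _)]mulrA [sg * (sg * _)]mulrA.
  rewrite sg_sqr mul1r addNr pmulr_rle0 // => h.
  by apply: nm_eq0; apply/eqP; rewrite -sqrf_eq0 eq_le h sqr_ge0.
have sz : sg%:C *: z = 0.
  apply: (range_orth j_dense) => v.
  by have := uP v; rewrite u0 linear0 scaler0 subr0 linear0l.
by rewrite -[z]scale1r -[1]/(1%:C) -sg_sqr rmorphM -scalerA sz scaler0.
Qed.

Lemma elliptic_selfadjoint : selfadjoint A.
Proof.
split; [exact: associated_is_operator|exact: elliptic_dense_domain|].
apply/seteqP; split=> [[x y] xy|q qA p pA]; last exact: associated_symmetric.
(* Here [x'] in the domain satisfies [(sg A + omega) x' = sg y + omega x]; it remains to see that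
   [x = x']. *)
have [x' xA] := elliptic_range (sg%:C *: y + omega%:C *: x).
have ssc (w : H) : sg%:C *: (sg%:C *: w) = w.
  by rewrite scalerA -rmorphM sg_sqr scale1r.
have yE : sg%:C *: (sg%:C *: y + omega%:C *: x) - (sg * omega)%:C *: x' =
    y + (sg * omega)%:C *: (x - x').
  by rewrite scalerDr ssc scalerA -rmorphM scalerBr addrA.
rewrite {}yE in xA.
suff xx : x - x' = 0.
  move: xA; rewrite xx scaler0 addr0; suff -> : x' = x by [].
  by apply/eqP; rewrite eq_sym -subr_eq0 xx.
(* Since [(sg A + omega) v = x - x'], pairing [v] with [(x, y)] and with [x'] leaves
   [|x - x'|^2 = 0]. *)
have [v vA] := elliptic_range (x - x').
have h1 := xy _ vA; have h2 := associated_symmetric vA xA.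
move: h1 h2 => /=.
set w := x - x'; set g := sg%:C *: w - _.
move=> h1 h2; have : inner g w = - ((sg * omega)%:C * inner v w).
  by rewrite {2}/w innerBr h1 h2 innerDr innerZr conjc_real opprD addNKr.
rewrite /g innerBl !innerZl => /(canRL (subrK _)); rewrite addNr => h3.
apply: nm_eq0; apply/eqP; rewrite -sqrf_eq0; apply/eqP/complexI.
by rewrite -innerxx -[inner w w]mul1r -[1]/(1%:C) -sg_sqr rmorphM -mulrA h3 mulr0.
Qed.

Lemma elliptic_semibounded : semibounded A.
Proof.
case: sgP elliptic => -> h; [left; exists (- omega)|right; exists omega];
  move=> p [u -> uP]; rewrite -uP form_diag nmE -rmorphXn -rmorphM lecR;
  have := h u; have := mulr_ge0 (ltW alpha_gt0) (sqr_ge0 (nm u)); lra.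
Qed.

End Elliptic.

(** * Location of the essential spectrum and conclusion *)

Lemma essential_spectrum_side (R : realType) (V H : hilbertType R)
    (j : {linear V -> H}) (a : {sesquilinear V -> R[i]}) (M Mj : R)
    (sg omega alpha l C : R) n (y : nat -> H) :
  (forall u v, nm (a u v) <= M * nm u * nm v) ->
  (forall u, nm (j u) <= Mj * nm u) -> is_symmetric_form a ->
  0 < alpha -> sg != 0 ->
  (forall u, alpha * nm u ^+ 2 <= sg * complex.Re (a u u) + omega * nm (j u) ^+ 2) ->
  (forall u, alpha * nm u ^+ 2 <=
     sg * (complex.Re (a u u) - l * nm (j u) ^+ 2) +
     C * \sum_(i < n) nm (inner (j u) (y i)) ^+ 2) ->
  forall mu, essential_spectrum (associated_operator j a) mu ->
    exists2 x, mu = x%:C & 0 < sg * (x - l).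
Proof.
move=> aM jM a_sym a0 sg0 ell fin mu muP.
have [mu_im|mu_im] := eqVneq (complex.Im mu) 0; last first.
  exfalso; apply: muP.
  (* For [theta = sg + i t] this [t] makes the real part of [theta (a u u - mu |j u|^2)] equal to
     [sg * a u u + omega |j u|^2]. *)
  pose t := (omega + sg * complex.Re mu) / complex.Im mu.
  apply: (fredholm_id_minus (theta := sg +i* t) (C := 0) (n := 0) (y := fun=> 0)
    aM jM a0); last by rewrite eq_complex negb_and sg0.
  move=> u; apply: le_trans (ell u) _; rewrite mul0r addr0 innerxx form_diag //.
  case: mu mu_im @t => x y' /= y0.
  move: (complex.Re (a u u)) (nm (j u) ^+ 2) => p h.
  by rewrite le_eqVlt; apply/orP; left; apply/eqP; field.
have muE : mu = (complex.Re mu)%:C.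
  by apply/eqP; rewrite eq_complex /= mu_im !eqxx.
(* If [sg * (mu - l) <= 0], replacing [l] by [mu] can only increase the right side of the bound, so
   it still gives coercivity up to finite rank. *)
exists (complex.Re mu) => //; rewrite ltNge; apply/negP => side; apply: muP.
apply: (fredholm_id_minus (theta := sg%:C) (C := C) (n := n) (y := y)
    aM jM a0); last by rewrite eq_complex negb_and sg0.
move=> u; apply: le_trans (fin u) _.
rewrite lerD2r muE innerxx form_diag // -rmorphM -rmorphB -rmorphM /=.
have := mulr_le0_ge0 side (sqr_ge0 (nm (j u))); lra.
Qed.

Theorem theorem1p3 (R : realType) (V H : hilbertType R)
    (j : {linear V -> H}) (j_inj : injective j) (j_cont : continuous j)
    (j_dense : dense (range j))
    (a : {sesquilinear V -> R[i]}) (a_cont : is_continuous_form a)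
    (a_sym : is_symmetric_form a)
    (lambda : R[i])
    (a_ess : essentially_coercive (shifted_form j a lambda)) :
  let A := associated_operator j a in
  (selfadjoint A /\ semibounded A) /\
  (forall l : R, lambda = l%:C ->
     essential_spectrum A `<=` [set x%:C | x in `]-oo, l[] \/
     essential_spectrum A `<=` [set x%:C | x in `]l, +oo[]).
Proof.
move=> A; have [Mj jM] := linear_nm_bounded j_cont.
have [M aM] := form_nm_bounded a_cont.
pose Q u v := a u v - (complex.Re lambda)%:C * inner (j u) (j v).
have QS : is_sesquilinear Q.
  have [al ar] := form_is_sesquilinear a.
  split=> k u u' v; rewrite /Q (linearP j).
    by rewrite al innerDl innerZl; ring.
  by rewrite ar innerDr innerZr; ring.
have QH u v : Q u v = (Q v u)^*%C.
  rewrite /Q (form_sym a_sym) [inner (j u) _]innerC rmorphB /= conjM.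
  by rewrite conjc_real.
have QM u v : nm (Q u v) <= (M + `|complex.Re lambda| * Mj ^+ 2) * nm u * nm v.
  apply: le_trans (nmD _ _) _; rewrite nmN nmM nmR -mulrA mulrDl mulrA lerD //.
  rewrite -mulrA ler_wpM2l //; apply: le_trans (cauchy_schwarz _ _) _.
  by rewrite expr2 mulrACA ler_pM ?nm_ge0.
have noseq := essentially_coercive_no_sequence a_sym a_ess.
have := coercive_finite_rank j_inj jM QS QH QM (normr_ge0 _) noseq.
move=> [n [y [sg [alpha [C [K [sgP a0 C0 K0 main]]]]]]].
have qE u : quad Q u = complex.Re (a u u) - complex.Re lambda * nm (j u) ^+ 2.
  by rewrite /quad /Q innerxx -rmorphM cReD cReN.
pose b := \sum_(i < n) nm (y i) ^+ 2.
(* All lower order terms are absorbed in [|j u|^2]: the sum of squares through [b], the [Im lambda]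
   term, and the shift by [Re lambda] contained in [Q]. *)
pose omega := C * b + K * `|complex.Im lambda| - sg * complex.Re lambda.
have ell u : alpha * nm u ^+ 2 <= sg * complex.Re (a u u) + omega * nm (j u) ^+ 2.
  apply: le_trans (main u) _; rewrite qE /omega.
  have := ler_wpM2l C0 (sum_inner_le n y (j u)); rewrite -/b; lra.
split; first split.
- exact: (elliptic_selfadjoint aM jM j_inj j_dense a_sym sgP a0 ell).
- exact: (elliptic_semibounded a_sym sgP a0 ell).
move=> l lE.
(* For real [lambda] the [K] term vanishes; the sum of squares is kept, as it has finite rank. *)
have fin u : alpha * nm u ^+ 2 <=
     sg * (complex.Re (a u u) - l * nm (j u) ^+ 2) +
     C * \sum_(i < n) nm (inner (j u) (y i)) ^+ 2.
  by have := main u; rewrite qE lE /= normr0 mul0r mulr0 addr0.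
have sg0 : sg != 0 by case: sgP => ->; rewrite ?oppr_eq0 oner_eq0.
have side := essential_spectrum_side aM jM a_sym a0 sg0 ell fin.
case: sgP side => -> side; [right|left] => mu /side[x -> xl]; exists x => //=;
  rewrite in_itv /= ?andbT; lra.
Qed.
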